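(* Let $n\ge 3$ and $\vec{x}=(x_1,\dots,x_n)\in\mathbb{Z}^n$. Then $$\vec{x}\cdot BD_n=\{\vec{y}\in\mathbb{Z}^n \mid \mathrm{tr}(\vec{x})=\mathrm{tr}(\vec{y}),\ I(\vec{x})=I(\vec{y})\}.$$ Moreover, $\vec{x}\cdot IBD_n=\vec{x}\cdot BD_n$.
   Context: A classical braid diagram of degree $n$ consists of $n$ strands in $\mathbb{R}^2$, each running monotonically from a top horizontal bar to a bottom horizontal bar, whose crossings are positive crossings $\sigma_i$ or negative crossings $\sigma_i^{-1}$ ($1\le i\le n-1$) between the strands in positions $i$ and $i+1$. Diagrams are considered up to planar isotopy fixing the bars pointwise. Equivalently, a diagram is a finite word (read top to bottom) in the letters $\sigma_i^{\pm1}$, where words are identified only via exchanging adjacent letters whose indices differ by at least $2$ (no braid relations, and $\sigma_i\sigma_i^{-1}$ is not trivial). $BD_n$ is the monoid of all classical braid diagrams of degree $n$; the product $b_1b_2$ is $b_1$ placed above $b_2$, and the identity is the diagram without crossings. Up-down action: integers $x_1,\dots,x_n$ are put on the top ends of the strands from left to right; following each strand downward, the integer increases by $1$ at each over-crossing and decreases by $1$ at each under-crossing. The tuple $\vec{y}$ read at the bottom from left to right is $\vec{x}\cdot\beta$. In $\sigma_i$ the strand going from position $i+1$ to position $i$ is over; in $\sigma_i^{-1}$ the strand going from position $i$ to position $i+1$ is over. Thus $\vec{x}\cdot\sigma_i^{\pm1}$ is obtained from $\vec{x}$ by replacing the $i$-th and $(i+1)$-th components by $x_{i+1}\pm1$ and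 $x_i\mp1$, respectively, and $\vec{x}\cdot(b_1b_2)=(\vec{x}\cdot b_1)\cdot b_2$. For a subset $N\subseteq BD_n$, $\vec{x}\cdot N=\{\vec{x}\cdot\beta\mid\beta\in N\}$. A diagram is irreducible if it has no non-alternating bigon, i.e. it is not represented by any word containing $\sigma_i\sigma_i^{-1}$ or $\sigma_i^{-1}\sigma_i$ as consecutive letters for some $i$. $IBD_n\subseteq BD_n$ is the set of irreducible classical braid diagrams. $\mathrm{tr}(\vec{x})=\sum_{i=1}^n x_i$, and $I(\vec{x})$ is the number of indices $i\in\{1,\dots,n\}$ such that ''$i$ is odd and $x_i$ is even'' or ''$i$ is even and $x_i$ is odd''. *)

(* Defs.v *)
From HB Require Import structures.
From Stdlib Require Import Relation_Operators.
From mathcomp Require Import all_boot all_order all_algebra.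
From mathcomp Require Import generic_quotient boolp classical_sets zify.

Set Implicit Arguments.
Unset Strict Implicit.
Unset Printing Implicit Defensive.

Import GRing.Theory.

Local Open Scope ring_scope.
Local Open Scope quotient_scope.
Local Open Scope classical_set_scope.

Section Words.
Variable n : nat.

(* Positions and coordinates are numbered from 0: the letter (i, true) is the
   positive crossing sigma_(i+1), which involves the 0-based positions i and
   i+1, and (i, false) is the negative crossing sigma_(i+1)^-1. *)
Definition letter : Type := ('I_n.-1 * bool)%type.

Lemma rpos_subproof (i : 'I_n.-1) : (i.+1 < n)%N.
Proof. by rewrite -ltn_predRL. Qed.

Definition lpos (i : 'I_n.-1) : 'I_n := widen_ord (leq_pred n) i.
Definition rpos (i : 'I_n.-1) : 'I_n := Ordinal (rpos_subproof i).

Definition far (a b : letter) : bool :=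
  (a.1.+1 < b.1)%N || (b.1.+1 < a.1)%N.

Definition exchange (w w' : seq letter) : Prop :=
  exists u v a b, [/\ far a b, w = u ++ a :: b :: v & w' = u ++ b :: a :: v].

Definition isotopic (w w' : seq letter) : bool :=
  `[< clos_refl_sym_trans _ exchange w w' >].

Lemma isotopic_refl : reflexive isotopic.
Proof. by move=> w; apply/asboolP; exact: rst_refl. Qed.

Lemma isotopic_sym : symmetric isotopic.
Proof. by move=> w w'; apply/asboolP/asboolP; exact: rst_sym. Qed.

Lemma isotopic_trans : transitive isotopic.
Proof.
move=> w w1 w2 /asboolP h1 /asboolP h2; apply/asboolP.
exact: rst_trans h1 h2.
Qed.

Canonical isotopic_equiv :=
  EquivRel isotopic isotopic_refl isotopic_sym isotopic_trans.

Lemma isotopic_cat w1 w1' w2 w2' :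
  isotopic w1 w1' -> isotopic w2 w2' -> isotopic (w1 ++ w2) (w1' ++ w2').
Proof.
move=> /asboolP h1 /asboolP h2; apply/asboolP.
apply: (@rst_trans _ _ _ (w1' ++ w2)).
  elim: h1 => [x y [u [v [a [b [ab -> ->]]]]]|x|x y _|x y z _ xy _ yz].
  - by apply: rst_step; exists u, (v ++ w2), a, b; rewrite -!catA.
  - exact: rst_refl.
  - exact: rst_sym.
  - exact: rst_trans xy yz.
elim: h2 => [x y [u [v [a [b [ab -> ->]]]]]|x|x y _|x y z _ xy _ yz].
- by apply: rst_step; exists (w1' ++ u), v, a, b; rewrite -!catA.
- exact: rst_refl.
- exact: rst_sym.
- exact: rst_trans xy yz.
Qed.

Definition act_letter (x : {ffun 'I_n -> int}) (a : letter) :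
    {ffun 'I_n -> int} :=
  let s : int := if a.2 then 1 else -1 in
  [ffun k => if k == lpos a.1 then x (rpos a.1) + s
             else if k == rpos a.1 then x (lpos a.1) - s
             else x k].

Definition act_word : {ffun 'I_n -> int} -> seq letter -> {ffun 'I_n -> int} :=
  foldl act_letter.

Lemma act_letter_far x a b :
  far a b -> act_letter (act_letter x a) b = act_letter (act_letter x b) a.
Proof.
case: a b => [i e] [j f]; rewrite /far /= => ij.
have [n1 n2 n3 n4] : [/\ (i == j :> nat) = false, (i == j.+1 :> nat) = false,
    (i.+1 == j :> nat) = false & (i.+1 == j.+1 :> nat) = false].
  by split; apply/eqP; lia.
apply/ffunP => k; rewrite !ffunE -!(inj_eq val_inj) /= n1 n2 n3 n4.
rewrite ![(j == _ :> nat)]eq_sym ![(j.+1 == _ :> nat)]eq_sym n1 n2 n3 n4.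
have [ki|_] := eqVneq (k : nat) i; first by rewrite ki n1 n2.
have [ki|_] := eqVneq (k : nat) i.+1; first by rewrite ki n3 n4.
by [].
Qed.

Lemma act_word_isotopic x w w' :
  isotopic w w' -> act_word x w = act_word x w'.
Proof.
move=> /asboolP; elim=> // [{}w {}w' [u [v [a [b [ab -> ->]]]]]|? ? ? _ -> _].
  by rewrite /act_word !foldl_cat /= act_letter_far.
by [].
Qed.

(* An occurrence of sigma_i sigma_i^-1 or of sigma_i^-1 sigma_i. *)
Definition has_cancelling_pair (w : seq letter) : Prop :=
  exists u v i e, w = u ++ (i, e) :: (i, ~~ e) :: v.

End Words.

Definition BD (n : nat) : Type := {eq_quot (isotopic_equiv n)}.
HB.instance Definition _ n := Choice.on (BD n).
HB.instance Definition _ n := EqQuotient.on (BD n).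

Section Diagrams.
Variable n : nat.

Definition bd_mul (b1 b2 : BD n) : BD n := \pi_(BD n) (repr b1 ++ repr b2).
Definition bd_one : BD n := \pi_(BD n) [::].

Lemma isotopicP (w w' : seq (letter n)) :
  reflect (\pi_(BD n) w = \pi_(BD n) w') (isotopic w w').
Proof. exact: (eqmodP (isotopic_equiv n)). Qed.

Lemma isotopic_repr (w : seq (letter n)) : isotopic (repr (\pi_(BD n) w)) w.
Proof. by apply/isotopicP; rewrite reprK. Qed.

Lemma bd_mul_pi w1 w2 :
  bd_mul (\pi_(BD n) w1) (\pi_(BD n) w2) = \pi_(BD n) (w1 ++ w2).
Proof. by apply/isotopicP/isotopic_cat; exact: isotopic_repr. Qed.

Lemma bd_mulA : associative bd_mul.
Proof.
elim/quotW=> w1; elim/quotW=> w2; elim/quotW=> w3.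
by rewrite (bd_mul_pi w2 w3) (bd_mul_pi w1 w2) !bd_mul_pi catA.
Qed.

Lemma bd_mul1b : left_id bd_one bd_mul.
Proof. by elim/quotW=> w; rewrite /bd_one bd_mul_pi. Qed.

Lemma bd_mulb1 : right_id bd_one bd_mul.
Proof. by elim/quotW=> w; rewrite /bd_one bd_mul_pi cats0. Qed.

HB.instance Definition _ :=
  isMonoid.Build (BD n) bd_mulA bd_mul1b bd_mulb1.

Definition act (x : {ffun 'I_n -> int}) (b : BD n) : {ffun 'I_n -> int} :=
  act_word x (repr b).

Lemma act_pi x w : act x (\pi_(BD n) w) = act_word x w.
Proof. by apply: act_word_isotopic; exact: isotopic_repr. Qed.

Lemma act1 x : act x 1%g = x.
Proof. exact: act_pi. Qed.

Lemma actM x b1 b2 : act x (b1 * b2)%g = act (act x b1) b2.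
Proof. by rewrite -[LHS]/(act x (bd_mul b1 b2)) act_pi /act_word foldl_cat. Qed.

Definition irreducible_bd (b : BD n) : Prop :=
  forall w : seq (letter n), \pi_(BD n) w = b -> ~ has_cancelling_pair w.

Definition IBD : set (BD n) := [set b | irreducible_bd b].

Definition orbit_of (x : {ffun 'I_n -> int}) (N : set (BD n)) :
    set {ffun 'I_n -> int} :=
  [set act x b | b in N].

Definition tr (x : {ffun 'I_n -> int}) : int := \sum_i x i.

(* The i-th coordinate in the 1-based numbering is the one of 0-based index
   i - 1, whence i.+1 below. *)
Definition parity_index (x : {ffun 'I_n -> int}) : nat :=
  #|[set i : 'I_n | odd i.+1 && (2 %| x i)%Z
                    || ~~ odd i.+1 && ~~ (2 %| x i)%Z]%SET|.

End Diagrams.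

(* Main.v *)
(* In the coordinates u_i = x_i + i a positive crossing merely swaps two
   neighbours and a negative one swaps them and then adds (-2, +2).  Hence the
   trace and the number of even u_i are invariant.  Conversely, one corrects the
   coordinates from left to right: swaps bring an entry of the right parity to
   position i, sigma_i and sigma_i^-1 in succession change it by 2, and the trace
   settles the last coordinate.
   For irreducibility, sigma_j^2 acts trivially, so each letter sigma_i^-1 may be
   replaced by sigma_j^2 sigma_i^-1 sigma_j^2 with j = i - 1 or j = i + 1 (this
   needs n >= 3), after which no sigma_i can meet a sigma_i^-1. *)

Require Import Defs.
From mathcomp Require Import all_boot all_order all_algebra.
From mathcomp Require Import boolp classical_sets.
From mathcomp Require Import perm generic_quotient zify.

Set Implicit Arguments.
Unset Strict Implicit.
Unset Printing Implicit Defensive.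

Import GRing.Theory.

Section Action.
Local Open Scope ring_scope.

Variable n : nat.
Implicit Types (x y : {ffun 'I_n -> int}) (a : letter n) (i : 'I_n.-1).

Definition crossing_sign a : int := if a.2 then 1 else -1.

Lemma lpos_neq_rpos i : (lpos i == rpos i) = false.
Proof. by apply/eqP => /(congr1 val) /=; lia. Qed.

Lemma act_letterl x a :
  act_letter x a (lpos a.1) = x (rpos a.1) + crossing_sign a.
Proof. by rewrite ffunE eqxx. Qed.

Lemma act_letterr x a :
  act_letter x a (rpos a.1) = x (lpos a.1) - crossing_sign a.
Proof. by rewrite ffunE eq_sym lpos_neq_rpos eqxx. Qed.

Lemma act_letter_out x a k :
  k != lpos a.1 -> k != rpos a.1 -> act_letter x a k = x k.
Proof. by rewrite ffunE => /negbTE-> /negbTE->. Qed.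

Lemma act_letter_lt x a (k : 'I_n) : (k < a.1)%N -> act_letter x a k = x k.
Proof.
by move=> lt_ka; apply: act_letter_out; apply/eqP => /(congr1 val) /=; lia.
Qed.

Lemma act_letterK x a : act_letter (act_letter x a) a = x.
Proof.
apply/ffunP => k.
have [->|kl] := eqVneq k (lpos a.1).
  by rewrite act_letterl act_letterr subrK.
have [->|kr] := eqVneq k (rpos a.1).
  by rewrite act_letterr act_letterl addrK.
by rewrite !act_letter_out.
Qed.

Lemma tr_act_letter x a : tr (act_letter x a) = tr x.
Proof.
have rl : rpos a.1 != lpos a.1 by rewrite eq_sym lpos_neq_rpos.
rewrite /tr (bigD1 (lpos a.1)) // (bigD1 (rpos a.1)) //=.
rewrite [RHS](bigD1 (lpos a.1)) // (bigD1 (rpos a.1)) //=.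
rewrite act_letterl act_letterr.
under eq_bigr => k /andP[kl kr] do rewrite act_letter_out //.
lia.
Qed.

Definition even_shift x (k : 'I_n) : bool := (2 %| x k + k%:Z)%Z.

Lemma parity_indexE x : parity_index x = #|[set k | even_shift x k]%SET|.
Proof.
apply: eq_card => k.
rewrite !inE /even_shift; lia.
Qed.

Lemma even_shift_act_letter x a k :
  even_shift (act_letter x a) k = even_shift x (tperm (lpos a.1) (rpos a.1) k).
Proof.
rewrite /even_shift; case: tpermP => [->|->|/eqP kl /eqP kr].
- by rewrite act_letterl /crossing_sign /=; case: a.2; lia.
- by rewrite act_letterr /crossing_sign /=; case: a.2; lia.
- by rewrite act_letter_out.
Qed.

Lemma parity_index_act_letter x a :
  parity_index (act_letter x a) = parity_index x.
Proof.
rewrite !parity_indexE; set s := tperm (lpos a.1) (rpos a.1).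
rewrite -[RHS](card_preimset _ (@perm_inj _ s)).
by apply: eq_card => k; rewrite !inE even_shift_act_letter.
Qed.

Lemma act_word_invariant x w :
  tr (act_word x w) = tr x /\ parity_index (act_word x w) = parity_index x.
Proof.
elim: w x => [|a w IHw] x //=.
by have [-> ->] := IHw (act_letter x a);
  rewrite tr_act_letter parity_index_act_letter.
Qed.

Lemma act_word_cat x w w' : act_word x (w ++ w') = act_word (act_word x w) w'.
Proof. exact: foldl_cat. Qed.

Lemma eq_card_even_shift x y (b : bool) : parity_index x = parity_index y ->
  #|[set j | even_shift x j == b]%SET| = #|[set j | even_shift y j == b]%SET|.
Proof.
have evenE z : [set j | even_shift z j == true]%SET = [set j | even_shift z j]%SET.
  by apply/setP => j; rewrite !inE eqb_id.
have oddE z :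
    [set j | even_shift z j == false]%SET = (~: [set j | even_shift z j])%SET.
  by apply/setP => j; rewrite !inE eqbF_neg.
rewrite !parity_indexE; case: b => eq_xy; first by rewrite !evenE.
by rewrite !oddE [LHS]cardsCs [RHS]cardsCs !finset.setCK eq_xy.
Qed.

Lemma exists_even_shift x y (k : 'I_n) :
    parity_index x = parity_index y ->
    (forall j : 'I_n, (j < k)%N -> x j = y j) ->
  exists2 j : 'I_n, (k <= j)%N & even_shift x j = even_shift y k.
Proof.
move=> eq_xy agree; set b := even_shift y k.
apply: contrapT => none.
suff : (#|[set j | even_shift x j == b]%SET| <
        #|[set j | even_shift y j == b]%SET|)%N.
  by rewrite (eq_card_even_shift b eq_xy) ltnn.
apply/proper_card/properP; split.
  apply/fintype.subsetP => j; rewrite !inE => /eqP xjb.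
  have [lt_jk|le_kj] := ltnP j k; last by case: none; exists j.
  by move: xjb; rewrite /even_shift agree // => ->.
exists k; rewrite !inE //; apply/eqP => xkb.
by apply: none; exists k.
Qed.

Lemma bring_down (d : nat) x (k j : 'I_n) : (j = k + d :> nat)%N ->
  exists w, (forall l : 'I_n, (l < k)%N -> act_word x w l = x l)
    /\ even_shift (act_word x w) k = even_shift x j.
Proof.
elim: d x j => [|d IHd] x j jE.
  by exists [::]; split=> //; congr even_shift; apply: val_inj; rewrite /= jE addn0.
have kd_n : (k + d < n.-1)%N by have := ltn_ord j; lia.
pose i := Ordinal kd_n; pose x' := act_letter x (i, true).
have [w [wlt wk]] := IHd x' (lpos i) erefl.
exists ((i, true) :: w); split=> [l lt_lk /=|/=].
  by rewrite wlt // act_letter_lt //=; lia.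
rewrite wk even_shift_act_letter tpermL; congr even_shift.
by apply: val_inj => /=; lia.
Qed.

Lemma translate x i (e : bool) (m : nat) :
  exists w, (forall l : 'I_n, (l < i)%N -> act_word x w l = x l)
    /\ act_word x w (lpos i) = x (lpos i) + crossing_sign (i, e) *+ (2 * m).
Proof.
elim: m x => [|m IHm] x; first by exists [::]; rewrite muln0 mulr0n addr0.
pose x' := act_letter (act_letter x (i, ~~ e)) (i, e).
have [w [wlt wi]] := IHm x'.
exists [:: (i, ~~ e), (i, e) & w]; split=> [l lt_li /=|/=].
  by rewrite wlt // !act_letter_lt.
rewrite wi /x' (act_letterl _ (i, e)) (act_letterr _ (i, ~~ e)).
by rewrite /crossing_sign /=; case: e {IHm x' w wlt wi} => /=; lia.
Qed.

Lemma agree_prefix x y (k : nat) :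
    parity_index x = parity_index y -> (k <= n.-1)%N ->
  exists w, forall j : 'I_n, (j < k)%N -> act_word x w j = y j.
Proof.
move=> eq_xy; elim: k => [|k IHk] lt_kn; first by exists [::].
have [w0 agree0] := IHk (ltnW lt_kn).
pose i := Ordinal lt_kn.
have par0 : parity_index (act_word x w0) = parity_index y.
  by rewrite (act_word_invariant x w0).2.
have [j le_kj ej] := exists_even_shift (k := lpos i) par0 agree0.
have [w1 [agree1 e1]] := bring_down (act_word x w0) (esym (subnKC le_kj)).
set x1 := act_word (act_word x w0) w1 in agree1 e1.
pose d := y (lpos i) - x1 (lpos i).
have d_even : (2 %| d)%Z.
  by move: e1; rewrite ej /even_shift /d; lia.
have [w2 [agree2 e2]] := translate x1 i (0 <= d) (`|d| %/ 2)%N.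
exists (w0 ++ w1 ++ w2) => l lt_lk; rewrite !act_word_cat -/x1.
have [l_k|l_k] := eqVneq l (lpos i).
  rewrite l_k e2 /crossing_sign /=; move: d_even; rewrite /d.
  by case: ifP; lia.
have lt_lk' : (l < k)%N by move: l_k lt_lk; rewrite -(inj_eq val_inj) /=; lia.
by rewrite agree2 // agree1 // agree0.
Qed.

Lemma act_word_transitive x y : (0 < n)%N ->
  tr x = tr y -> parity_index x = parity_index y -> exists w, act_word x w = y.
Proof.
move=> n_gt0 eq_tr eq_par.
have [w agree] := agree_prefix eq_par (leqnn _).
exists w; pose last_pos := Ordinal (ltac:(by rewrite ltn_predL) : (n.-1 < n)%N).
have agree' k : k != last_pos -> act_word x w k = y k.
  move=> /eqP k_last; apply: agree.
  have : k <> n.-1 :> nat by move=> ?; apply/k_last/val_inj.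
  by have := ltn_ord k; lia.
apply/ffunP => k; have [->|] := eqVneq k last_pos; last exact: agree'.
have := (act_word_invariant x w).1.
rewrite eq_tr /tr (bigD1 last_pos) //= (eq_bigr y) // [RHS](bigD1 last_pos) //=.
exact: addIr.
Qed.

End Action.

Section Irreducibility.
Local Open Scope quotient_scope.

Variable n : nat.
Implicit Types (i j c : 'I_n.-1) (w : seq (letter n)).

(* What the strands in positions i and i+1 see of w: their mutual crossings with
   signs, and an anonymous mark None for each crossing of index i - 1 or i + 1.
   Forgetting which of the two it is makes this invariant under exchange. *)
Definition view i w : seq (option bool) :=
  [seq if a.1 == i then Some a.2 else None
     | a : letter n <- w & (a.1 <= i.+1)%N && (i <= a.1.+1)%N].

Lemma view_cat i w w' : view i (w ++ w') = view i w ++ view i w'.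
Proof. by rewrite /view filter_cat map_cat. Qed.

Lemma view_isotopic i w w' : isotopic w w' -> view i w = view i w'.
Proof.
move=> /asboolP; elim=> [{}w {}w' [u [v [a [b [ab -> ->]]]]]|//|//|? ? ? _ -> _ -> //].
rewrite !view_cat; congr (_ ++ _); rewrite /view /=.
move: ab; rewrite /far => ab.
case: ifP => near_a; case: ifP => near_b //=.
by rewrite !ifN_eq // -(inj_eq val_inj) /=; lia.
Qed.

Definition compatible (s t : option bool) : bool :=
  if s is Some b then t != Some (~~ b) else true.

Definition reduced w : Prop := forall i, path compatible (Some true) (view i w).

Lemma reduced_irreducible w : reduced w -> irreducible_bd (\pi_(BD n) w).
Proof.
move=> red_w w' /isotopicP iso [u [v [i [e w'E]]]].
have := red_w i; rewrite -(view_isotopic i iso) w'E view_cat cat_path => /andP[_].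
by rewrite /view /= leqnSn /= eqxx /= eqxx andbF.
Qed.

Lemma path_view_cons c w i (e : bool) : e || (i != c) ->
  path compatible (Some true) (view c w) ->
  path compatible (Some true) (view c ((i, e) :: w)).
Proof.
rewrite /view /=; case: ifP => //= _; case: eqP => [_|_ _] /=.
  by rewrite orbF => ->.
by case: [seq _ | _ <- _ & _] => //= t s /andP[].
Qed.

Lemma reduced_cons_pos i w : reduced w -> reduced ((i, true) :: w).
Proof. by move=> red_w c; apply: path_view_cons. Qed.

Lemma reduced_pad_neg i j w : (j = i.+1 :> nat) \/ (i = j.+1 :> nat) ->
  reduced w ->
  reduced [:: (j, true), (j, true), (i, false), (j, true), (j, true) & w].
Proof.
move=> ij red_w c; have [->|ic] := eqVneq c i; last first.
  by do 5![apply: path_view_cons; first by rewrite //= eq_sym].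
have red_jw := path_view_cons (c := i) (i := j) (e := true) isT (red_w i).
have near_ij : (j <= i.+1)%N && (i <= j.+1)%N by lia.
have ji : (j == i) = false by apply/eqP => /(congr1 val) /=; lia.
by move: red_jw; rewrite /view /= near_ij leqnSn /= ji eqxx /=.
Qed.

Lemma exists_neighbour i : (3 <= n)%N ->
  exists j : 'I_n.-1, (j = i.+1 :> nat) \/ (i = j.+1 :> nat).
Proof.
move=> n_ge3; have lt_i := ltn_ord i.
have [lt_Si|ge_Si] := ltnP i.+1 n.-1; first by exists (Ordinal lt_Si); left.
have lt_pi : (i.-1 < n.-1)%N by lia.
by exists (Ordinal lt_pi); right => /=; lia.
Qed.

Lemma exists_reduced (x : {ffun 'I_n -> int}) w : (3 <= n)%N ->
  exists2 w', reduced w' & act_word x w' = act_word x w.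
Proof.
move=> n_ge3; elim: w x => [|[i e] w IHw] x; first by exists [::].
have [w' red_w' w'E] := IHw (act_letter x (i, e)).
case: e w'E => w'E.
  by exists ((i, true) :: w'); [exact: reduced_cons_pos|].
have [j ij] := exists_neighbour i n_ge3.
exists [:: (j, true), (j, true), (i, false), (j, true), (j, true) & w'].
  exact: reduced_pad_neg.
by rewrite /= !act_letterK.
Qed.

End Irreducibility.

Local Open Scope classical_set_scope.

Theorem theorem1p1 (n : nat) (n_ge3 : (3 <= n)%N) (x : {ffun 'I_n -> int}) :
  orbit_of x [set: BD n]
    = [set y : {ffun 'I_n -> int} |
        tr x = tr y /\ parity_index x = parity_index y]
  /\ orbit_of x (@IBD n) = orbit_of x [set: BD n].
Proof.
split; apply/seteqP; split=> [y [b _ <-]|y].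
- by have [] := act_word_invariant x (repr b).
- move=> [eq_tr eq_par].
  have [w <-] := act_word_transitive (ltn_trans (isT : 0 < 2) n_ge3) eq_tr eq_par.
  by exists (\pi_(BD n)%qT w) => //; rewrite act_pi.
- by exists b.
- move=> [b _ <-].
  have [w red_w wE] := exists_reduced x (repr b) n_ge3.
  exists (\pi_(BD n)%qT w); first exact: reduced_irreducible.
  by rewrite act_pi.
Qed.
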